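(* Let $G$ be a connected graph with $m$ edges on vertex set $\{1,\ldots,n\}$ such that the largest eigenvalue $\rho(G)$ of its adjacency matrix satisfies $\rho(G)>\sqrt{m}$. Suppose that $(x_1,\ldots,x_n)$ is a positive unit eigenvector of the adjacency matrix for the eigenvalue $\rho(G)$. If \[ x_ix_j\geq\frac{1}{8\sqrt{m}} \] for every edge $\{i,j\}\in E(G)$, then \[ bk(G)>\frac{1}{12}\sqrt[4]{2m}. \]
   Context: All graphs are finite and simple. The booksize $bk(G)$ is the maximum number of triangles of $G$ sharing a common edge, i.e. $bk(G)=\max_{\{u,v\}\in E(G)}|N(u)\cap N(v)|$, where $N(u)$ is the neighborhood of $u$. *)

(* Defs.v *)
From mathcomp Require Import all_boot all_order all_algebra.
From mathcomp Require Import reals.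
Set Implicit Arguments.
Unset Strict Implicit.
Unset Printing Implicit Defensive.
Import Order.TTheory GRing.Theory Num.Theory.
Local Open Scope ring_scope.

Record sgraph (n : nat) := SGraph {
  adj : rel 'I_n;
  adj_sym : symmetric adj;
  adj_irrefl : irreflexive adj
}.

Definition neighborhood n (G : sgraph n) (u : 'I_n) : {set 'I_n} :=
  [set v | adj G u v].

Definition edges n (G : sgraph n) : {set {set 'I_n}} :=
  [set [set p.1; p.2] | p in [set p : 'I_n * 'I_n | adj G p.1 p.2]].

Definition connected_graph n (G : sgraph n) : Prop :=
  forall u v : 'I_n, connect (adj G) u v.

(* The maximum of the empty family is 0, so an edgeless graph has booksize 0. *)
Definition booksize n (G : sgraph n) : nat :=
  \max_(p : 'I_n * 'I_n | adj G p.1 p.2)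
    #|neighborhood G p.1 :&: neighborhood G p.2|.

Definition adjmx (R : realType) n (G : sgraph n) : 'M[R]_n :=
  \matrix_(i, j) (adj G i j)%:R.

(* [eigenvalue] refers to left (row) eigenvectors; adjacency matrices being
   symmetric, this is the same as for column eigenvectors. *)
Definition is_largest_eigenvalue (R : realType) n (A : 'M[R]_n) (rho : R) :
    Prop :=
  eigenvalue A rho /\ (forall a : R, eigenvalue A a -> a <= rho).

(* Main.v *)
Require Import Defs.
From mathcomp Require Import all_boot all_order all_algebra.
From mathcomp Require Import reals.
From mathcomp Require Import ring lra.
Import Order.TTheory GRing.Theory Num.Theory.
Local Open Scope ring_scope.

(** In fact [rho > sqrt m] forces [bk(G) > rho / 8].  Normalise at a vertex [u]
    where the eigenvector attains its maximum [M], and compare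
    [rho^2 M = \sum_(q in N(u)) \sum_(p ~ q) x_p] with [m M], edge by edge.
    - An edge [jk] inside [N(u)] gains [x_j + x_k - M], which is at most the
      smaller of the two entries and is positive only if the larger one is at
      least [M / 2].  A vertex [w] of [N(u)] lies on at most [bk(G)] such edges.
    - The eigenvalue equations at [u] and at [p] show that the edges at a vertex
      [p] outside [N(u)] lose, in total, at least
      [x_p x(N(u) \ N(p)) / (2 M)].
    Exchanging the sums, [w] accounts for a loss of
    [x_w x(V \ (N(u) :|: N(w))) / (2 M)].  If [wj] is an edge inside [N(u)] with
    [x_j >= M / 2], then the last set contains all of [N(j)] but [2 bk(G)]
    vertices, so it has weight at least [(rho / 2 - 2 bk(G)) M]; when
    [8 bk(G) <= rho] the loss at [w] covers the gain [bk(G) x_w]. *)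

(** * Edge-by-edge comparison at a vertex of maximum weight *)

Section EigenvalueBound.
Variables (R : realFieldType) (T : finType) (e : rel T).
Variables (x : T -> R) (rho b : R).
Hypothesis e_sym : symmetric e.
Hypothesis x_ge0 : forall i, 0 <= x i.
Hypothesis x_eigen : forall i, \sum_j (e i j)%:R * x j = rho * x i.
Hypothesis codegree_le :
  forall i j, e i j -> \sum_k (e i k)%:R * (e j k)%:R <= b.
Hypothesis b_le : 8 * b <= rho.
Variable u : T.
Hypothesis x_max : forall i, x i <= x u.
Hypothesis x_gt0 : 0 < x u.
Hypothesis rho_gt0 : 0 < rho.

Let M := x u.
Let a i j : R := (e i j)%:R.
Let s i : R := (e u i)%:R.
Let c i : R := 1 - s i.
(** Marks the vertices that may have to pay for a positive gain. *)
Let F w : R := [exists j, [&& e u j, e w j & M <= 2 * x j]]%:R.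

Let a_sym i j : a i j = a j i. Proof. by rewrite /a e_sym. Qed.
Let a_ge0 i j : 0 <= a i j. Proof. exact: ler0n. Qed.
Let a_le1 i j : a i j <= 1. Proof. by rewrite /a lern1 leq_b1. Qed.
Let s_ge0 i : 0 <= s i. Proof. exact: ler0n. Qed.
Let c_ge0 i : 0 <= c i. Proof. by rewrite subr_ge0 lern1 leq_b1. Qed.
Let F_ge0 i : 0 <= F i. Proof. exact: ler0n. Qed.

(** If [x q] is at least [M / 2], then [F p = 1] and [x p] alone covers the gain, as [x q <= M];
    symmetrically for [x p]. If both are below [M / 2], the gain is negative. *)
Lemma edge_gain_le p q :
  s p * s q * a p q * (x p + x q - M) <=
  s p * s q * a p q * (F p * x p) + s p * s q * a p q * (F q * x q).
Proof.
rewrite /s /a; case up: (e u p); last by rewrite !mul0r addr0.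
case uq: (e u q); last by rewrite mulr0 !mul0r addr0.
case pq: (e p q); last by rewrite mulr0 !mul0r addr0.
rewrite !mul1r.
have Fx0 i : 0 <= F i * x i by rewrite mulr_ge0.
have F1 i j : e u j -> e i j -> M <= 2 * x j -> F i = 1.
  move=> uj ij hj; rewrite /F; case: existsP => // -[].
  by exists j; rewrite uj ij hj.
have := Fx0 p; have := Fx0 q; have := x_max p; have := x_max q; rewrite -/M.
have [hq|hq] := leP M (2 * x q); first by rewrite (F1 p q) //; lra.
have [hp|hp] := leP M (2 * x p); first by rewrite (F1 q p) ?(e_sym q) //; lra.
lra.
Qed.

(** The codegree bound on the edge [uw] gives [w] at most [b] neighbours in [N(u)]; the 2 comes from
    summing over ordered pairs. *)
Lemma gain_le :
  \sum_p \sum_q s p * s q * a p q * (x p + x q - M) <=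
  2 * b * \sum_w s w * F w * x w.
Proof.
have half : \sum_p \sum_q s p * s q * a p q * (F p * x p) <=
            b * \sum_w s w * F w * x w.
  rewrite mulr_sumr; apply: ler_sum => p _.
  rewrite (eq_bigr (fun q => (s p * F p * x p) * (s q * a p q))); last first.
    by move=> q _; ring.
  rewrite -mulr_sumr /s; case up: (e u p); last by rewrite !mul0r mulr0.
  by rewrite mulrC ler_wpM2r ?mulr_ge0 //; exact: codegree_le.
apply: (@le_trans _ _ (\sum_p \sum_q
    (s p * s q * a p q * (F p * x p) + s p * s q * a p q * (F q * x q)))).
  by apply: ler_sum => p _; apply: ler_sum => q _; exact: edge_gain_le.
under eq_bigr do rewrite big_split /=.
rewrite big_split /= [X in _ + X]exchange_big /=.
under [X in _ + X]eq_bigr => p _ do under eq_bigr => q _ do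
  rewrite (mulrC (s q)) (a_sym q p).
lra.
Qed.

(** Over ordered pairs, an edge from [p] into [N(u)] loses [M - x p] twice, while one between two
    outside vertices loses [M] once at each end. *)
Lemma loss_at_ge p :
  x p * (\sum_w s w * (1 - a p w) * x w) <=
  M * (2 * (\sum_q s q * a p q) * (M - x p) + (\sum_q c q * a p q) * M).
Proof.
set n := \sum_w _; set D := \sum_q s q * _; set E := \sum_q c q * _.
pose aw := \sum_q s q * a p q * x q; pose o := \sum_q c q * a p q * x q.
have uE : aw + n = rho * M.
  by rewrite -x_eigen -big_split /=; apply: eq_bigr => q _; rewrite /s; ring.
have pE : aw + o = rho * x p.
  by rewrite -x_eigen -big_split /=; apply: eq_bigr => q _; rewrite /c /a; ring.
have awD : aw <= D * M.
  by rewrite mulr_suml; apply: ler_sum => q _; rewrite ler_wpM2l ?mulr_ge0.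
have oE : o <= E * M.
  by rewrite mulr_suml; apply: ler_sum => q _; rewrite ler_wpM2l ?mulr_ge0.
have aw0 : 0 <= aw by apply: sumr_ge0 => q _; rewrite !mulr_ge0.
have Mp : 0 <= M - x p by rewrite subr_ge0.
have h1 : aw * (M - x p) <= D * M * (M - x p) by rewrite ler_wpM2r.
have h1' : 0 <= aw * (M - x p) by rewrite mulr_ge0.
have h2 : o * M <= E * M * M by rewrite ler_wpM2r // ltW.
(* Eliminates [rho] between the eigenvalue equations at [u] and [p]. *)
have key : x p * n = aw * (M - x p) + o * M.
  have -> : n = rho * M - aw by lra.
  have -> : o = rho * x p - aw by lra.
  ring.
rewrite key; lra.
Qed.

(** [N(j)] weighs [rho * x j], at least [4 * b * M]; the edges [uj] and [wj] each remove at most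
    [b * M]. *)
Lemma missed_weight_ge w : s w * F w * x w * (2 * b * M) <=
  s w * F w * x w * \sum_p c p * (1 - a w p) * x p.
Proof.
rewrite /s /F; case uw: (e u w); last by rewrite !mul0r.
case: existsP => [[j /and3P[uj wj hj]]|_]; last by rewrite mulr0 !mul0r.
rewrite !mul1r ler_wpM2l //.
have u_j : \sum_p a u p * a j p * x p <= b * M.
  apply: (@le_trans _ _ ((\sum_p a u p * a j p) * M)).
    by rewrite mulr_suml; apply: ler_sum => p _; rewrite ler_wpM2l ?mulr_ge0.
  by rewrite ler_wpM2r ?(ltW x_gt0) //; exact: codegree_le.
have w_j : \sum_p a w p * a j p * x p <= b * M.
  apply: (@le_trans _ _ ((\sum_p a w p * a j p) * M)).
    by rewrite mulr_suml; apply: ler_sum => p _; rewrite ler_wpM2l ?mulr_ge0.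
  by rewrite ler_wpM2r ?(ltW x_gt0) //; exact: codegree_le.
apply: (@le_trans _ _ (\sum_p a j p * x p - \sum_p a u p * a j p * x p
                       - \sum_p a w p * a j p * x p)).
  have -> : \sum_p a j p * x p = rho * x j by exact: x_eigen.
  have h1 : rho * M <= rho * (2 * x j) by rewrite ler_pM2l.
  have h2 : 8 * b * M <= rho * M by rewrite ler_pM2r.
  lra.
(* The union bound, vertex by vertex. *)
rewrite -!sumrB; apply: ler_sum => p _.
rewrite -!mulrBl ler_wpM2r // /c /s /a.
by case: (e u p); case: (e w p); case: (e j p); rewrite /= ?mulr1n ?mulr0n; lra.
Qed.

Lemma loss_ge : 2 * b * (\sum_w s w * F w * x w) * M <=
  M * (\sum_p c p *
         (2 * (\sum_q s q * a p q) * (M - x p) + (\sum_q c q * a p q) * M)).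
Proof.
apply: (@le_trans _ _ (\sum_p c p * (x p * \sum_w s w * (1 - a p w) * x w))).
  rewrite [leRHS](_ : _ = \sum_w s w * x w * \sum_p c p * (1 - a w p) * x p).
    rewrite mulr_sumr mulr_suml; apply: ler_sum => w _.
    rewrite [leLHS](_ : _ = s w * F w * x w * (2 * b * M)); last by ring.
    apply: le_trans (missed_weight_ge w) _.
    rewrite ler_wpM2r //.
      apply: sumr_ge0 => p _.
      by rewrite !mulr_ge0 // subr_ge0.
    by rewrite ler_wpM2r // ler_piMr // /F lern1 leq_b1.
  under eq_bigr do rewrite mulrA mulr_sumr.
  rewrite exchange_big /=; apply: eq_bigr => w _; rewrite mulr_sumr.
  by apply: eq_bigr => p _; rewrite (a_sym p w); ring.
rewrite mulr_sumr; apply: ler_sum => p _.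
by rewrite [leRHS]mulrCA ler_wpM2l // loss_at_ge.
Qed.

Lemma sqr_eigenvalue_le : 2 * rho ^+ 2 <= \sum_p \sum_q a p q.
Proof.
(* The eigenvalue equation, used at each [q] in [N(u)] and then at [u]. *)
have walk : \sum_p \sum_q a p q * s q * x p = rho ^+ 2 * M.
  rewrite exchange_big /=.
  rewrite (eq_bigr (fun q => rho * (s q * x q))).
    by rewrite -mulr_sumr [X in rho * X]x_eigen; rewrite /M; ring.
  move=> q _; rewrite mulrCA -x_eigen mulr_sumr; apply: eq_bigr => p _.
  by rewrite a_sym /a; ring.
have walk' : \sum_p \sum_q a p q * s p * x q = rho ^+ 2 * M.
  rewrite -walk exchange_big /=; apply: eq_bigr => p _; apply: eq_bigr => q _.
  by rewrite a_sym.
pose D p := \sum_q s q * a p q; pose E p := \sum_q c q * a p q.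
have mid : \sum_p \sum_q c p * s q * a p q * (x p - M) =
           \sum_p c p * (D p * (x p - M)).
  apply: eq_bigr => p _; rewrite mulr_suml mulr_sumr; apply: eq_bigr => q _.
  ring.
have mid' : \sum_p \sum_q s p * c q * a p q * (x q - M) =
            \sum_p c p * (D p * (x p - M)).
  rewrite -mid exchange_big /=; apply: eq_bigr => p _; apply: eq_bigr => q _.
  by rewrite a_sym; ring.
have out : \sum_p \sum_q c p * c q * a p q * M = \sum_p c p * (E p * M).
  apply: eq_bigr => p _; rewrite mulr_suml mulr_sumr; apply: eq_bigr => q _.
  ring.
have split_loss : \sum_p c p * (2 * D p * (M - x p) + E p * M) =
   \sum_p c p * (E p * M) - 2 * \sum_p c p * (D p * (x p - M)).
  by rewrite mulr_sumr -sumrB; apply: eq_bigr => p _; ring.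
(* Splits [s q * x p + s p * x q - M] according to which ends of the pair lie in [N(u)]. *)
have decomp : \sum_p \sum_q s p * s q * a p q * (x p + x q - M) =
    \sum_p \sum_q a p q * s q * x p + \sum_p \sum_q a p q * s p * x q
    - (\sum_p \sum_q a p q) * M
    - \sum_p \sum_q c p * s q * a p q * (x p - M)
    - \sum_p \sum_q s p * c q * a p q * (x q - M)
    + \sum_p \sum_q c p * c q * a p q * M.
  rewrite mulr_suml -!(big_split, sumrB) /=; apply: eq_bigr => p _.
  rewrite mulr_suml -!(big_split, sumrB) /=; apply: eq_bigr => q _.
  rewrite /c; ring.
have gain := gain_le; have := loss_ge.
rewrite [leRHS]mulrC ler_pM2r // split_loss => loss.
rewrite -(ler_pM2r x_gt0) -/M.
move: gain loss; rewrite decomp walk walk' mid mid' out; lra.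
Qed.

End EigenvalueBound.

(** * Edge counts and codegrees of a graph *)

Lemma card_adj_le_double_edges n (G : sgraph n) :
  (#|[set p : 'I_n * 'I_n | adj G p.1 p.2]| <= 2 * #|edges G|)%N.
Proof.
set P := [set p | _]; pose f (p : 'I_n * 'I_n) : {set 'I_n} := [set p.1; p.2].
rewrite -sum1_card (partition_big f (mem (edges G))) /=; last first.
  by move=> p Pp; apply/imsetP; exists p.
rewrite mulnC -sum_nat_const; apply: leq_sum => _ /imsetP[[i j] _ ->] /=.
rewrite sum1dep_card; apply: leq_trans (_ : #|[set (i, j); (j, i)]| <= 2)%N.
  apply/subset_leq_card/subsetP => -[k l].
  rewrite !inE /= => /andP[kl /eqP kl_ij].
  have kNl : k != l by apply: contraTneq kl => ->; rewrite adj_irrefl.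
  have := set21 k l; have := set22 k l.
  rewrite -/(f (k, l)) kl_ij !inE !xpair_eqE.
  case/orP=> /eqP lE /orP[] /eqP kE; move: kNl; rewrite kE lE ?eqxx //.
  by rewrite orbT.
by rewrite cards2; case: (_ != _).
Qed.

Lemma codegree_le_booksize n (G : sgraph n) (i j : 'I_n) : adj G i j ->
  (#|neighborhood G i :&: neighborhood G j| <= booksize G)%N.
Proof.
move=> ij.
exact: (leq_bigmax_cond (P := fun p => adj G p.1 p.2) (F := fun p =>
  #|neighborhood G p.1 :&: neighborhood G p.2|) (i, j) ij).
Qed.

Theorem booksize_gt_eigenvalue (R : realType) (n : nat) (G : sgraph n) (rho : R)
    (x : 'rV[R]_n) :
  Num.sqrt (#|edges G|%:R : R) < rho -> x *m adjmx R G = rho *: x ->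
  (forall i, 0 <= x 0 i) -> x != 0 -> rho < 8 * (booksize G)%:R.
Proof.
move=> rho_gt x_eigen x_ge0 x_neq0.
have rho_gt0 : 0 < rho by apply: le_lt_trans rho_gt; rewrite sqrtr_ge0.
have [i0 xi0] : exists i, 0 < x 0 i.
  apply/existsP; apply: contraNT x_neq0 => /existsPn x_le0.
  apply/eqP/rowP => i; rewrite mxE; apply/le_anti.
  by rewrite x_ge0 leNgt x_le0.
pose u := [arg max_(i > i0) x 0 i]%O.
have x_max i : x 0 i <= x 0 u.
  by rewrite /u; case: arg_maxP => // k _; apply.
(* Under [8 * bk(G) <= rho] the comparison would give [rho ^+ 2 <= m]. *)
rewrite ltNge; apply/negP => b_le.
suff : rho ^+ 2 <= (#|edges G|)%:R.
  rewrite leNgt => /negP; apply.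
  rewrite -[ltLHS]sqr_sqrtr ?ler0n // ltr_pXn2r // ?nnegrE ?sqrtr_ge0 //.
  exact: ltW.
have eigenE i : \sum_j (adj G i j)%:R * x 0 j = rho * x 0 i.
  move/rowP: x_eigen => /(_ i); rewrite !mxE => <-; apply: eq_bigr => j _.
  by rewrite !mxE mulrC adj_sym.
have codegE i j : adj G i j ->
    \sum_k (adj G i k)%:R * (adj G j k)%:R <= (booksize G)%:R :> R.
  move=> ij; apply: (@le_trans _ _
    (#|neighborhood G i :&: neighborhood G j|)%:R); last first.
    by rewrite ler_nat codegree_le_booksize.
  rewrite -sum1_card natr_sum [leRHS]big_mkcond /=; apply: ler_sum => k _.
  by rewrite !inE; case: (adj G i k); case: (adj G j k); rewrite ?mul1r ?mul0r.
have := @sqr_eigenvalue_le R 'I_n (adj G) (fun i => x 0 i) rho _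
  (adj_sym G) x_ge0 eigenE codegE b_le u x_max (lt_le_trans xi0 (x_max i0))
  rho_gt0.
rewrite pair_big /= (_ : \sum_p _ =
    (#|[set p : 'I_n * 'I_n | adj G p.1 p.2]|)%:R); last first.
  rewrite -sum1dep_card natr_sum [RHS]big_mkcond /=; apply: eq_bigr => p _.
  by case: (adj G _ _).
have : (#|[set p : 'I_n * 'I_n | adj G p.1 p.2]|)%:R
         <= (2 * #|edges G|)%:R :> R.
  by rewrite ler_nat card_adj_le_double_edges.
rewrite natrM; lra.
Qed.

(** * The fourth-root bound *)

Theorem theorem7 (R : realType) (n m : nat) (G : sgraph n) (rho : R)
    (x : 'rV[R]_n)
    (conn_G : connected_graph G)
    (m_edges : #|edges G| = m)
    (rho_largest : is_largest_eigenvalue (adjmx R G) rho)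
    (rho_gt : Num.sqrt (m%:R : R) < rho)
    (x_eigen : x *m adjmx R G = rho *: x)
    (x_pos : forall i : 'I_n, 0 < x 0 i)
    (x_unit : \sum_(i < n) x 0 i ^+ 2 = 1)
    (x_edge : forall i j : 'I_n, adj G i j ->
       1 / (8 * Num.sqrt (m%:R : R)) <= x 0 i * x 0 j) :
  1 / 12 * Num.sqrt (Num.sqrt (2 * m%:R : R)) < (booksize G)%:R.
Proof.
have x_neq0 : x != 0.
  apply: contra_eq_neq x_unit => ->.
  rewrite big1 ?(eq_sym 0) ?oner_neq0 // => i _.
  by rewrite mxE expr0n.
have rho_lt : rho < 8 * (booksize G)%:R.
  apply: (@booksize_gt_eigenvalue R n G rho x) => //; first by rewrite m_edges.
  by move=> i; exact: ltW.
suff : 1 / 12 * Num.sqrt (Num.sqrt (2 * m%:R : R)) <= Num.sqrt m%:R / 8 by lra.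
(* For [m = 0] both sides vanish; the strict inequality is already in [rho_gt]. *)
have [->|m_gt0] := posnP m; first by rewrite mulr0 !sqrtr0 mulr0 mul0r.
set r := Num.sqrt (m%:R : R).
have r_ge1 : 1 <= r by rewrite -sqrtr1 ler_sqrt ?ler0n // ler1n.
have rr : r ^+ 2 = m%:R by rewrite sqr_sqrtr ?ler0n.
(* Here [3 / 2 = 12 / 8]; in fourth powers the claim is [2 * r ^+ 2 <= 81 / 16 * r ^+ 4], true since
   [1 <= r]. *)
suff : Num.sqrt (Num.sqrt (2 * m%:R : R)) <= 3 / 2 * r by lra.
rewrite -rr -(@ger0_norm _ (3 / 2 * r)) ?mulr_ge0 //; try lra.
rewrite -sqrtr_sqr ler_sqrt ?sqr_ge0 //.
rewrite -(@ger0_norm _ ((3 / 2 * r) ^+ 2)) ?sqr_ge0 //.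
rewrite -sqrtr_sqr ler_sqrt ?sqr_ge0 //.
have r2_ge1 : 1 <= r ^+ 2 by rewrite exprn_ege1.
have : r ^+ 2 * 1 <= r ^+ 2 * r ^+ 2 by rewrite ler_wpM2l ?sqr_ge0.
lra.
Qed.
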